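(* Let $n>0$, $k\in\{1,\ldots,n\}$ and $p\in\{0,\ldots,n-k\}$. Then, for every finite $n$-dimensional simplicial complex $K$ and every $\nu\in[0,1]$, the sequence $\left(\frac{\mathbb{E}_{\nu,d}(b_p)}{f_n(K)\,(n+1)!^d}\right)_{d\geq 0}$ converges and its limit does not depend on $K$ (it depends only on $n,k,p,\nu$).
   Context: $f_n(K)$ is the number of $n$-dimensional simplices of $K$. $\mathrm{Sd}(K)$ is the first barycentric subdivision of $K$ and $\mathrm{Sd}^d(K)$ the $d$-th iterated one ($\mathrm{Sd}^0(K)=K$). A $q$-simplex of $\mathrm{Sd}(K)$ is written $[\hat\sigma_0,\ldots,\hat\sigma_q]$, where $\hat\sigma_i$ is the barycenter of a simplex $\sigma_i$ of $K$ and $\sigma_i$ is a proper face of $\sigma_{i+1}$. For $\sigma\in K$, $\overline{D}(\sigma)$ is the union of all closed simplices $[\hat\sigma_0,\ldots,\hat\sigma_q]$ of $\mathrm{Sd}(K)$ with $\sigma_0=\sigma$. For a simplicial complex $K$, $k\geq 1$ and a simplicial cochain $\epsilon\in C^{k-1}(K;\mathbb{Z}/2\mathbb{Z})$, $V_\epsilon$ is the subcomplex of $\mathrm{Sd}(K)$ which is the union of the $\overline{D}(\sigma)$ over the $k$-simplices $\sigma$ of $K$ with $\langle d\epsilon,\sigma\rangle\neq 0$, where $d:C^{k-1}(K;\mathbb{Z}/2\mathbb{Z})\to C^k(K;\mathbb{Z}/2\mathbb{Z})$ is the coboundary operator. For $\epsilon\in C^{k-1}(\mathrm{Sd}^d(K);\mathbb{Z}/2\mathbb{Z})$,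 $V_\epsilon$ is formed with $\mathrm{Sd}^d(K)$ in place of $K$, so $V_\epsilon\subset \mathrm{Sd}^{d+1}(K)$. For $\nu\in[0,1]$, $\mu_\nu$ is the product probability measure on the finite set $C^{k-1}(\mathrm{Sd}^d(K);\mathbb{Z}/2\mathbb{Z})$ for which the values of $\epsilon$ on the different $(k-1)$-simplices are independent and each is $0$ with probability $\nu$ and $1$ with probability $1-\nu$. With $b_p(V_\epsilon)=\dim H_p(V_\epsilon;\mathbb{Z}/2\mathbb{Z})$, $$\mathbb{E}_{\nu,d}(b_p)=\int_{C^{k-1}(\mathrm{Sd}^d(K);\mathbb{Z}/2\mathbb{Z})}b_p(V_\epsilon)\,d\mu_\nu(\epsilon).$$ *)

(* Defs.v *)
From HB Require Import structures.
From mathcomp Require Import all_boot all_order all_algebra.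
From mathcomp Require Import reals.

Set Implicit Arguments.
Unset Strict Implicit.
Unset Printing Implicit Defensive.

Import Order.TTheory GRing.Theory Num.Theory.

Local Open Scope ring_scope.

(* The simplices are the elements of [simp], all nonempty.  [vert] is only an
   ambient finite type: x is a vertex of K when [set x] \in K.  The empty
   complex is allowed; V_eps below can be empty. *)
Record complex := Complex {
  vert : finType;
  simp :> {set {set vert}};
  simp_neq0 : forall s : {set vert}, s \in simp -> s != set0;
  simp_face : forall s t : {set vert},
    s \in simp -> t \subset s -> t != set0 -> t \in simp }.

Definition is_simplex (K : complex) (q : nat) (s : {set vert K}) : bool :=
  (s \in simp K) && (#|s| == q.+1).

Definition simplex (K : complex) (q : nat) := {s : {set vert K} | is_simplex q s}.

Definition f_ (n : nat) (K : complex) : nat := #|{: simplex K n}|.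

Definition has_dim (K : complex) (n : nat) : Prop :=
  (exists2 s, s \in simp K & #|s| = n.+1) /\
  (forall s : {set vert K}, s \in simp K -> (#|s| <= n.+1)%N).

Section BarycentricSubdivision.
Variable K : complex.

(* The barycenter of s is represented by s itself, and the simplex
   [s_0^, .., s_q^] by the chain {s_0, .., s_q}. *)
Definition sd_simp : {set {set {set vert K}}} :=
  [set c | [&& c != set0, c \subset simp K &
            [forall s in c, forall t in c, (s \subset t) || (t \subset s)]]].

Lemma sd_simp_neq0 c : c \in sd_simp -> c != set0.
Proof. by rewrite inE => /and3P[]. Qed.

Lemma sd_simp_face (c e : {set {set vert K}}) :
  c \in sd_simp -> e \subset c -> e != set0 -> e \in sd_simp.
Proof.
rewrite !inE => /and3P[_ cK ch] ec ->; rewrite (subset_trans ec cK) /=.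
apply/forall_inP => s /(subsetP ec) sc.
apply/forall_inP => t /(subsetP ec) tc.
by move/forall_inP: ch => /(_ _ sc)/forall_inP/(_ _ tc).
Qed.

Definition Sd : complex := Complex sd_simp_neq0 sd_simp_face.

Definition Dbar (s : {set vert K}) : {set {set {set vert K}}} :=
  [set e in sd_simp | [exists c in sd_simp,
     [&& e \subset c, s \in c & [forall t in c, s \subset t]]]].

End BarycentricSubdivision.

Definition cochain (K : complex) (q : nat) := {ffun simplex K q -> 'F_2}.

(* Only used for k > 0, where it is d : C^{k-1} -> C^k. *)
Definition coboundary (K : complex) (k : nat) (eps : cochain K k.-1) :
    cochain K k :=
  [ffun s : simplex K k =>
     \sum_(t : simplex K k.-1 | val t \subset val s) eps t].

Section Veps.
Variables (K : complex) (k : nat) (eps : cochain K k.-1).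

Definition V_simp : {set {set {set vert K}}} :=
  \bigcup_(s : simplex K k | coboundary eps s != 0) Dbar (val s).

Lemma V_simp_neq0 e : e \in V_simp -> e != set0.
Proof.
by case/bigcupP => s _; rewrite inE => /andP[/sd_simp_neq0].
Qed.

Lemma V_simp_face (e e' : {set {set vert K}}) :
  e \in V_simp -> e' \subset e -> e' != set0 -> e' \in V_simp.
Proof.
case/bigcupP => s ds; rewrite inE => /andP[eK /exists_inP[c cK]].
case/and3P=> ec sc smin e'e e'0; apply/bigcupP; exists s => //.
rewrite inE (sd_simp_face eK e'e e'0) /=; apply/exists_inP; exists c => //.
by rewrite (subset_trans e'e ec) sc.
Qed.

Definition V : complex := Complex V_simp_neq0 V_simp_face.

End Veps.

Section Homology.
Variable K : complex.

Definition chain (q : nat) := {ffun simplex K q -> ('F_2)^o}.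

Definition boundary (q : nat) (c : chain q.+1) : chain q :=
  [ffun t : simplex K q =>
     \sum_(s : simplex K q.+1 | val t \subset val s) c s].

Lemma boundary_is_linear q : linear (@boundary q).
Proof.
move=> a c1 c2; apply/ffunP => t; rewrite !ffunE scaler_sumr -big_split /=.
by apply: eq_bigr => s _; rewrite !ffunE.
Qed.

HB.instance Definition _ q :=
  GRing.isLinear.Build 'F_2 (chain q.+1) (chain q) _ (@boundary q)
    (@boundary_is_linear q).

Definition cycles (q : nat) : {vspace chain q} :=
  match q with
  | 0 => fullv
  | q'.+1 => lker (linfun (@boundary q'))
  end.

Definition boundaries (q : nat) : {vspace chain q} :=
  limg (linfun (@boundary q)).

(* The quotient chain q -> chain q / boundaries q, realized as the projection
   onto a complement of boundaries q along boundaries q. *)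
Definition mod_boundaries (q : nat) : 'End(chain q) :=
  daddv_pi ((boundaries q)^C)%VS (boundaries q).

Definition homology (q : nat) : {vspace chain q} :=
  (mod_boundaries q @: cycles q)%VS.

Definition betti (q : nat) : nat := \dim (homology q).

Lemma lker_mod_boundaries q : lker (mod_boundaries q) = boundaries q.
Proof.
have dis : ((boundaries q)^C :&: boundaries q = 0)%VS.
  by rewrite capvC capv_compl.
apply/vspaceP => v; rewrite memv_ker.
have vE : daddv_pi ((boundaries q)^C)%VS (boundaries q) v
        + daddv_pi (boundaries q) ((boundaries q)^C)%VS v = v.
  by apply: daddv_pi_add; rewrite // addvC addv_complf memvf.
apply/eqP/idP => [v0|vB].
  by rewrite -vE [X in X + _]v0 add0r memv_pi.
apply: (addIr (daddv_pi (boundaries q) ((boundaries q)^C)%VS v)).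
by rewrite [LHS]vE add0r daddv_pi_id // capv_compl.
Qed.

Lemma boundary_boundary q (c : chain q.+2) : boundary (boundary c) = 0.
Proof.
apply/ffunP => r; rewrite !ffunE.
under eq_bigr do rewrite ffunE.
rewrite (exchange_big_dep xpredT) //=; apply: big1 => s _.
rewrite sumr_const.
have [rs|nrs] := boolP (val r \subset val s); last first.
  rewrite (_ : #|_| = 0%N) ?mulr0n //; apply: eq_card0 => t.
  rewrite unfold_in; apply/negP => /andP[rt ts]; case/negP: nrs.
  exact: subset_trans rt ts.
rewrite (_ : #|_| = 2%N).
  by rewrite -mulr_natr (_ : 2%:R = 0 :> 'F_2) ?mulr0 //; apply/val_inj.
have /andP[sK /eqP cs] := valP s; have /andP[rK /eqP cr] := valP r.
have cD : #|val s :\: val r| = 2%N.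
  by rewrite cardsD (setIidPr rs) cs cr -addn2 addKn.
rewrite -[RHS]cD.
have inj : {in val s :\: val r &, injective (fun x => x |: val r)}.
  move=> x y; rewrite !inE => /andP[xr _] _ /setP/(_ x).
  by rewrite !inE eqxx (negPf xr) /= orbF => /esym/eqP.
rewrite -(card_in_imset inj) -(card_image (f := val)); last exact: val_inj.
apply: eq_card => T; apply/imageP/imsetP => [[t]|[x]].
  rewrite unfold_in => /andP[rt ts] ->.
  have /andP[_ /eqP ct] := valP t.
  have : #|val t :\: val r| == 1%N.
    by rewrite cardsD (setIidPr rt) ct cr subSnn.
  case/cards1P => x tE; have : x \in val t :\: val r by rewrite tE set11.
  rewrite inE => /andP[xr xt]; exists x.
    by rewrite inE xr (subsetP ts).
  by rewrite -{1}(setID (val t) (val r)) (setIidPr rt) tE setUC.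
rewrite inE => /andP[xr xs] ->.
have Ts : x |: val r \subset val s by rewrite subUset sub1set xs.
have TK : is_simplex q.+1 (x |: val r).
  rewrite /is_simplex cardsU1 xr cr eqxx andbT.
  apply: (simp_face sK Ts); rewrite -card_gt0 cardsU1 xr //.
by exists (Sub (x |: val r) TK); rewrite ?unfold_in ?SubK // subsetUr.
Qed.

Lemma bettiE q : betti q = (\dim (cycles q) - \dim (boundaries q))%N.
Proof.
rewrite /betti /homology -(limg_ker_dim (mod_boundaries q) (cycles q)).
rewrite lker_mod_boundaries (capv_idPr _) ?addKn //.
case: q => [|q]; first exact: subvf.
apply/subvP => _ /memv_imgP[c _ ->]; rewrite memv_ker !lfunE /=.
by rewrite boundary_boundary.
Qed.

End Homology.

Section Expectation.
Variable R : realType.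

(* Mass of the single cochain eps for the product measure mu_nu. *)
Definition mu (nu : R) (K : complex) (q : nat) (eps : cochain K q) : R :=
  \prod_(t : simplex K q) (if eps t == 0 then nu else 1 - nu).

Definition expected_betti (nu : R) (K : complex) (k p d : nat) : R :=
  \sum_(eps : cochain (iter d Sd K) k.-1) (betti (V eps) p)%:R * mu nu eps.

End Expectation.

(* Main.v *)
From HB Require Import structures.
Require Import Defs.
From mathcomp Require Import all_classical all_reals all_analysis.
From mathcomp Require Import all_boot all_order all_algebra.
From mathcomp Require Import lra ring.

Set Implicit Arguments.
Unset Strict Implicit.
Unset Printing Implicit Defensive.

Import Order.TTheory GRing.Theory Num.Theory.
Import numFieldNormedType.Exports.

(** The expectation is almost additive over the [n]-simplices of [K], and the
defect is invisible at the scale [(n+1)! ^ d].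

Locality.  For a subcomplex [L] of [K], the part of [V eps] that lies in [Sd L] is
the [V] of the restriction of [eps] to [L].  As the measure is a product, this
restriction is distributed according to the measure of [L] (lemma
[sum_mu_restrict]).

Almost additivity.  If [K] is the union of [L1] and [L2], then the dimensions of
the spaces of chains and of boundaries of [K] are the sums of those of [L1] and
[L2], up to the number of simplices in the intersection; so the same holds for
Betti numbers up to a factor [3] ([betti_decomposition]).  Being a union is
inherited by subdivisions and by [V eps].

Growth.  If the simplices of [L] are contained in [N] sets of at most [m] vertices,
then those of [Sd L] are contained in [N * m!] such sets, namely the complete
flags; so the [d]-th subdivision has at most [N * m! ^ d * 2 ^ m] simplices
([card_iter_Sd]).  A complex of dimension less than [n] thus has [O (n! ^ d)]
simplices after [d] subdivisions.

Deleting the simplices of [K] one by one, these facts show that the expectation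
for [K] is [f_n K] times that of the standard [n]-simplex, with an error
[O (n! ^ d)] ([expected_betti_approx]).  Let [u d] be the expectation for the
standard simplex divided by [(n+1)! ^ d].  Applied to the first subdivision of
the standard simplex, which has [(n+1)!] simplices of dimension [n], the estimate
says that [u d.+1 - u d] is [O ((n+1) ^ - d)]; as [n > 0], the sequence [u]
converges.  Applied to an arbitrary [K], it says that the normalized
expectation of [K] differs from [u] by a sequence tending to [0]. *)

(** * Flags and complete orderings *)

Local Open Scope nat_scope.

Section Flags.
Variable T : finType.
Implicit Types (l : seq T) (c : {set {set T}}).

(** The simplex of the barycentric subdivision cut out by an ordering of the
vertices: the nonempty initial segments of [l]. *)
Definition flag l : {set {set T}} :=
  [set [set x in take (i : 'I_(size l)).+1 l] | i : 'I_(size l)].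

Lemma card_flag_le l : #|flag l| <= size l.
Proof. by rewrite -[leqRHS]card_ord leq_imset_card. Qed.

Lemma take_count_sorted (leT : rel T) (P : pred T) l :
  transitive leT -> sorted leT l ->
  (forall x y, P y -> leT x y -> P x) ->
  take (count P l) l = filter P l.
Proof.
move=> leT_tr + Pdown; elim: l => //= x l IHl.
rewrite path_sortedE // => /andP[/allP xl /IHl {}IHl].
case: ifPn => Px /=; first by rewrite IHl.
have : ~~ has P l.
  by apply/hasPn => y yl; apply: contra Px => /Pdown; apply; apply: xl.
by rewrite has_filter negbK -size_filter => /eqP->.
Qed.

Definition is_chain c :=
  [forall s in c, forall t in c, (s \subset t) || (t \subset s)].

(** Every chain of subsets refines to a complete flag.  Sorting the vertices by
the number of members of the chain that miss them makes each member an initial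
segment. *)
Lemma chain_sub_flag c l0 :
  uniq l0 -> is_chain c -> set0 \notin c ->
  (forall (t : {set T}) x, t \in c -> x \in t -> x \in l0) ->
  exists2 l, perm_eq l l0 & c \subset flag l.
Proof.
move=> Ul0 /forall_inP cc c0 cl0.
pose key x := #|[set u in c | x \notin u]|.
pose l := sort (relpre key leq) l0.
have pl : perm_eq l l0 by rewrite perm_sort.
exists l => //; apply/subsetP => t tc.
have t0 : 0 < #|t| by rewrite card_gt0; apply: contraNneq c0 => <-.
have tl x : x \in t -> x \in l by rewrite (perm_mem pl); apply: cl0 tc.
have filt : count [in t] l = #|t|.
  rewrite -size_filter cardE; apply: perm_size; apply: uniq_perm.
  - by rewrite filter_uniq // (perm_uniq pl).
  - exact: enum_uniq.
  by move=> x; rewrite mem_filter mem_enum; case: (boolP (x \in t)) => // /tl.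
have tP : take #|t| l = filter [in t] l.
  rewrite -filt; apply: (take_count_sorted (leT := relpre key leq)).
  - by move=> y x z /=; apply: leq_trans.
  - by apply: sort_sorted => x y; apply: leq_total.
  move=> x y yt /=; apply: contraLR => xt; rewrite -ltnNge.
  apply: proper_card; apply/properP; split.
    apply/subsetP => u; rewrite !inE => /andP[uc yu]; rewrite uc /=.
    have /orP[ut|tu] := forall_inP (cc u uc) t tc.
      by apply: contra xt => /(subsetP ut).
    by rewrite (subsetP tu) in yu.
  by exists t; rewrite !inE tc //= yt.
have lt : #|t|.-1 < size l.
  by rewrite prednK // -filt count_size.
apply/imsetP; exists (Ordinal lt) => //=; rewrite prednK // tP.
by apply/setP => x; rewrite !inE mem_filter; case: (boolP (x \in t)) => // /tl.
Qed.

Lemma card_set_take l i : uniq l -> i <= size l -> #|[set x in take i l]| = i.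
Proof.
move=> Ul il; rewrite cardsE (card_uniqP _) ?take_uniq //.
by rewrite size_take_min (minn_idPl il).
Qed.

Lemma card_flag l : uniq l -> #|flag l| = size l.
Proof.
move=> Ul; rewrite card_imset ?card_ord // => i j /(congr1 (fun A : {set T} => #|A|)).
by rewrite !card_set_take // => -[] /ord_inj.
Qed.

(** The member of a flag of cardinality [i] is the set of the first [i] entries,
so the flag recovers the list entry by entry. *)
Lemma flag_inj l l' : uniq l -> uniq l' -> size l = size l' ->
  flag l = flag l' -> l = l'.
Proof.
move=> Ul Ul' ss fE.
have tE i : i <= size l -> [set x in take i l] = [set x in take i l'].
  case: i => [|i lt_i]; first by rewrite !take0.
  have : [set x in take i.+1 l] \in flag l'.
    by rewrite -fE; apply/imsetP; exists (Ordinal lt_i).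
  case/imsetP => j _ eqij; move: (congr1 (fun A : {set T} => #|A|) eqij).
  by rewrite !card_set_take // => ij; rewrite eqij ij.
elim/last_ind: l l' Ul Ul' ss tE {fE} => [|l x IHl] l'.
  by case: l'.
case/lastP: l' => [|l' x']; first by rewrite size_rcons.
rewrite !rcons_uniq !size_rcons => /andP[xl Ul] /andP[xl' Ul'] [ss] tE.
have ll' : l = l'.
  apply: IHl => // i lei; have := tE i (leqW lei).
  by rewrite -!cats1 !takel_cat -?ss.
rewrite -ll'; congr rcons.
have := tE (size l).+1 (leqnn _); rewrite !take_oversize ?size_rcons ?ss // => /setP/(_ x).
rewrite !inE !mem_rcons !inE eqxx /= -ll' (negPf xl) orbF => /esym/eqP; exact.
Qed.

End Flags.

(** * Growth of the number of simplices under subdivision *)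

Lemma chain_max (K : complex) c : c \in simp (Sd K) ->
  exists2 t, t \in c & forall s, s \in c -> s \subset t.
Proof.
rewrite inE => /and3P[/set0Pn[t0 t0c] _ /forall_inP cc].
case: (arg_maxnP (fun t : {set vert K} => #|t|) t0c) => t tc tmax.
exists t => // s sc; have /orP[//|ts] := forall_inP (cc s sc) t tc.
by have /eqP -> : t == s by rewrite eqEcard ts; apply: tmax.
Qed.

Section Cover.
Variable m : nat.

(** Counting covering sets rather than simplices makes the growth rate under
subdivision come out as exactly [m`!], without any recursion on the numbers of
simplices of each dimension. *)
Definition covered (K : complex) (N : nat) :=
  exists S : seq {set vert K},
    [/\ size S <= N, {in S, forall u : {set vert K}, #|u| <= m} &
        forall s, s \in simp K -> exists2 u : {set vert K}, u \in S & s \subset u].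

Lemma covered_self K :
  (forall s, s \in simp K -> #|s| <= m) -> covered K #|simp K|.
Proof.
move=> Km; exists (enum (simp K)); split; first by rewrite cardE.
  by move=> u; rewrite mem_enum => /Km.
by move=> s sK; exists s; rewrite ?mem_enum.
Qed.

Lemma covered_leq K N s : covered K N -> s \in simp K -> #|s| <= m.
Proof.
by case=> S [_ Sm SK] /SK[u /Sm um /subset_leq_card su]; apply: leq_trans um.
Qed.

Lemma covered_card K N : covered K N -> #|simp K| <= N * 2 ^ m.
Proof.
case=> S [SN Sm SK].
apply: (@leq_trans (\sum_(u <- S) #|powerset u|)); last first.
  apply: (@leq_trans (\sum_(u <- S) 2 ^ m)).
    rewrite big_seq [leqRHS]big_seq; apply: leq_sum => u /Sm um.
    by rewrite card_powerset leq_pexp2l.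
  by rewrite big_const_seq count_predT iter_addn_0 mulnC leq_mul2r SN orbT.
elim: S (simp K) SK {SN Sm} => [|u S IHS] A SA.
  by rewrite big_nil leqn0 cards_eq0; apply/set0Pn => -[s /SA[]].
rewrite big_cons -(cardsID (powerset u) A) leq_add ?subset_leq_card ?subsetIr //.
apply: IHS => s; rewrite inE powersetE => /andP[su /SA[v]].
by rewrite inE => /predU1P[->|vS sv]; [rewrite (negPf su)|exists v].
Qed.

(** Each covering set [u] is replaced by the flags of all orderings of [u]. *)
Lemma covered_Sd K N : covered K N -> covered (Sd K) (N * m`!).
Proof.
case=> S [SN Sm SK].
exists (flatten [seq [seq flag l | l <- permutations (enum u)] | u : {set vert K} <- S]).
split.
- apply: leq_trans (_ : size S * m`! <= _); last by rewrite leq_mul2r SN orbT.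
  elim: S Sm {SN SK} => //= u S IHS Sm.
  rewrite size_cat size_map mulSn leq_add //.
    rewrite size_permutations ?enum_uniq // -cardE.
    by apply: leq_fact; apply: Sm; rewrite mem_head.
  by apply: IHS => v vS; apply: Sm; rewrite inE vS orbT.
- move=> c /flattenP[_ /mapP[u uS ->] /mapP[l]].
  rewrite mem_permutations => /perm_size sl ->.
  by rewrite (leq_trans (card_flag_le l)) // sl -cardE Sm.
move=> c cK; have [t tc tmax] := chain_max cK.
move: cK; rewrite inE => /and3P[_ /subsetP cK cc].
have [u uS tu] := SK t (cK t tc).
have [|s x /tmax st xs|l pl cl] := chain_sub_flag (enum_uniq u) cc.
- by apply/negP => /cK/simp_neq0; rewrite eqxx.
- by rewrite mem_enum (subsetP tu) ?(subsetP st).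
exists (flag l) => //; apply/flattenP.
exists [seq flag l | l <- permutations (enum u)]; first exact: map_f.
by apply: map_f; rewrite mem_permutations.
Qed.

Lemma card_iter_Sd K N d :
  covered K N -> #|simp (iter d Sd K)| <= N * m`! ^ d * 2 ^ m.
Proof.
move=> KN; apply: covered_card; elim: d => [|d /covered_Sd] /=.
  by rewrite muln1.
by rewrite -mulnA -expnSr.
Qed.

End Cover.

Lemma covered_weaken m m' K N : m <= m' -> covered m K N -> covered m' K N.
Proof.
move=> mm' [S [SN Sm SK]]; exists S; split=> // u /Sm um; exact: leq_trans mm'.
Qed.

Section StandardSimplex.
Variable n : nat.

Lemma std_neq0 (s : {set 'I_n}) : s \in [set s | s != set0] -> s != set0.
Proof. by rewrite inE. Qed.

Lemma std_face (s t : {set 'I_n}) : s \in [set s : {set 'I_n} | s != set0] ->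
  t \subset s -> t != set0 -> t \in [set t : {set 'I_n} | t != set0].
Proof. by move=> _ _; rewrite inE. Qed.

Definition std_simplex : complex := Complex std_neq0 std_face.

Lemma covered_std : covered n std_simplex 1.
Proof.
exists [:: setT]; split=> // [u|s _]; last by exists setT; rewrite ?mem_head.
by rewrite inE => /eqP->; rewrite cardsT card_ord.
Qed.

End StandardSimplex.

(** The top-dimensional simplices of the subdivided simplex are the complete
flags, hence correspond to the orderings of the vertices. *)
Lemma f_Sd_std n : f_ n (Sd (std_simplex n.+1)) = (n.+1)`!.
Proof.
pose P := permutations (enum 'I_n.+1).
have UP : uniq P by apply: permutations_uniq.
have sz : size (enum 'I_n.+1) = n.+1 by rewrite -cardE card_ord.
have PP l : l \in P -> uniq l /\ size l = n.+1.
  rewrite mem_permutations => pl.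
  by rewrite (perm_uniq pl) (perm_size pl) enum_uniq.
have cP c : is_simplex (K := Sd (std_simplex n.+1)) n c =
            (c \in [seq flag l | l <- P]).
  apply/andP/mapP => [[cK /eqP cn]|[l /PP[Ul sl] ->]].
    move: cK; rewrite inE => /and3P[_ /subsetP cK cc].
    have [|t x _ _|l pl cl] := chain_sub_flag (enum_uniq 'I_n.+1) cc.
    - by apply/negP => /cK/simp_neq0; rewrite eqxx.
    - by rewrite mem_enum.
    exists l; first by rewrite mem_permutations.
    apply/eqP; rewrite eqEcard cl cn.
    by rewrite (leq_trans (card_flag_le l)) // (perm_size pl) sz.
  split; last by rewrite card_flag ?sl.
  rewrite inE; apply/and3P; split.
  - by rewrite -card_gt0 card_flag ?sl.
  - apply/subsetP => _ /imsetP[i _ ->]; rewrite inE -card_gt0 card_set_take //.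
  - apply/forall_inP => _ /imsetP[i _ ->]; apply/forall_inP => _ /imsetP[j _ ->].
    have sub (a b : nat) : a <= b -> [set x in take a l] \subset [set x in take b l].
      move=> ab; apply/subsetP => x; rewrite !inE -(take_takel l ab).
      exact: mem_take.
    by apply/orP; case/orP: (leq_total i j) => ij; [left|right]; apply: sub.
rewrite /f_ card_sig (eq_card (B := mem [seq flag l | l <- P])) //.
rewrite (card_uniqP _) ?size_map ?size_permutations ?enum_uniq ?sz //.
rewrite map_inj_in_uniq // => l l' /PP[Ul sl] /PP[Ul' sl'].
by apply: flag_inj; rewrite ?sl ?sl'.
Qed.

(** * Embeddings and decompositions of complexes *)

(** Subcomplexes are handled through injective simplicial maps because the
vertex type changes at every subdivision: the iterated subdivisions of a
complex and of a subcomplex live over types that cannot be identified by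
computation.  Injectivity is asked on the whole ambient type so that taking
images of sets is again injective. *)
Record embedding (L K : complex) := Embedding {
  emb_fun :> vert L -> vert K;
  emb_inj : injective emb_fun;
  emb_simp : forall s, s \in simp L -> emb_fun @: s \in simp K }.

Section EmbeddingTheory.
Variables (L K : complex) (f : embedding L K).

Lemma emb_is_simplex q s : is_simplex q s -> is_simplex q (f @: s).
Proof.
case/andP=> sL sq; rewrite /is_simplex emb_simp //=.
by rewrite card_imset //; apply: emb_inj.
Qed.

Definition emb_simplex q (s : simplex L q) : simplex K q :=
  exist _ (f @: val s) (emb_is_simplex (valP s)).

Lemma emb_simplex_inj q : injective (@emb_simplex q).
Proof.
move=> s t /(congr1 val) /(imset_inj (@emb_inj _ _ f)) st.
exact: val_inj.
Qed.

Lemma sub_imset_emb (t s : {set vert L}) :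
  (f @: t \subset f @: s) = (t \subset s).
Proof.
apply/subsetP/subsetP => [fts x xt|ts _ /imsetP[x xt ->]].
  have /imsetP[y ys /emb_inj ->//] := fts _ (imset_f f xt).
by rewrite imset_f ?ts.
Qed.

Lemma face_emb q r (s : simplex L q) (t : simplex K r) :
  val t \subset f @: val s ->
  exists2 t' : simplex L r, t = emb_simplex t' & val t' \subset val s.
Proof.
move=> ts; pose u := f @^-1: val t.
have us : u \subset val s.
  apply/subsetP => x; rewrite inE => /(subsetP ts) /imsetP[y ys /emb_inj ->//].
have fu : f @: u = val t.
  apply/setP => y; apply/imsetP/idP => [[x]|yt]; first by rewrite inE => xt ->.
  have /imsetP[x xs xy] := subsetP ts _ yt.
  by exists x; rewrite ?inE -?xy.
have /andP[tK /eqP tr] := valP t.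
have cu : #|u| = r.+1 by rewrite -tr -fu card_imset //; apply: emb_inj.
have uL : is_simplex r u.
  rewrite /is_simplex cu eqxx andbT; have /andP[sL _] := valP s.
  by apply: simp_face sL us _; rewrite -card_gt0 cu.
by exists (exist _ u uL) => //; apply: val_inj; rewrite /= fu.
Qed.

Lemma sd_emb_simp (c : {set {set vert L}}) :
  c \in simp (Sd L) -> [set f @: s | s : {set vert L} in c] \in simp (Sd K).
Proof.
rewrite !inE => /and3P[c0 /subsetP cL cc]; apply/and3P; split.
- by rewrite imset_eq0.
- by apply/subsetP => _ /imsetP[s /cL sL ->]; apply: emb_simp.
apply/forall_inP => _ /imsetP[s sc ->]; apply/forall_inP => _ /imsetP[t tc ->].
by rewrite !sub_imset_emb; move/forall_inP: cc => /(_ s sc)/forall_inP/(_ t tc).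
Qed.

Definition sd_emb : embedding (Sd L) (Sd K) :=
  @Embedding (Sd L) (Sd K) (fun s => f @: s) (imset_inj (@emb_inj _ _ f)) sd_emb_simp.

Definition restrict q (eps : cochain K q) : cochain L q :=
  [ffun s => eps (emb_simplex s)].

Lemma coboundary_restrict k (eps : cochain K k.-1) (s : simplex L k) :
  coboundary (restrict eps) s = coboundary eps (emb_simplex s).
Proof.
rewrite !ffunE (reindex_omap (@emb_simplex _) (fun t =>
   [pick t' : simplex L k.-1 | emb_simplex t' == t])) /=; last first.
  move=> t /face_emb[t' -> _]; case: pickP => [u /eqP <- //|/(_ t')].
  by rewrite eqxx.
apply: eq_big => [t|t ts]; last by rewrite ffunE.
rewrite sub_imset_emb; case: (val t \subset _) => //=.
case: pickP => [u /eqP /emb_simplex_inj ->|/(_ t)]; rewrite eqxx //.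
Qed.

Lemma V_emb_simp k (eps : cochain K k.-1) (c : {set {set vert L}}) :
  c \in simp (V (restrict eps)) -> sd_emb @: c \in simp (V eps).
Proof.
case/bigcupP => s; rewrite coboundary_restrict => ds.
rewrite inE => /andP[cL /exists_inP[e eL /and3P[ce se emin]]].
apply/bigcupP; exists (emb_simplex s) => //; rewrite inE sd_emb_simp //=.
apply/exists_inP; exists (sd_emb @: e); first exact: sd_emb_simp.
rewrite imsetS //= imset_f //=.
apply/forall_inP => _ /imsetP[t te ->]; rewrite sub_imset_emb.
by move/forall_inP: emin; apply.
Qed.

(** The trace of [V eps] on the subdivision of [L] is no larger than the [V] of the
restricted cochain: a simplex [c] in the dual cell of [s] has [s] as a face of all
its members, so [s] already lies in [L] as soon as [c] does. *)
Lemma V_emb_simpV k (eps : cochain K k.-1) (c : {set {set vert L}}) :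
  c \in simp (Sd L) -> sd_emb @: c \in simp (V eps) ->
  c \in simp (V (restrict eps)).
Proof.
move=> cL /bigcupP[s ds]; rewrite inE => /andP[_ /exists_inP[e eK]].
case/and3P=> ce se /forall_inP emin.
have smin t : t \in c -> val s \subset f @: t.
  by move=> tc; apply/emin/(subsetP ce)/imset_f.
have [t0 t0c] := set0Pn _ (simp_neq0 cL).
move: (cL); rewrite inE => /and3P[_ /subsetP ctL cc].
have t0L := ctL _ t0c.
have t0s : is_simplex #|t0|.-1 t0.
  by rewrite /is_simplex t0L prednK ?eqxx // card_gt0; apply: simp_neq0 t0L.
have [s' sE _] := @face_emb _ _ (exist _ t0 t0s) s (smin _ t0c).
apply/bigcupP; exists s'; first by rewrite coboundary_restrict -sE.
rewrite inE; apply/andP; split=> //.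
have s't t : t \in c -> val s' \subset t.
  by move=> tc; rewrite -sub_imset_emb; have := smin t tc; rewrite sE.
apply/exists_inP; exists (val s' |: c); last first.
  rewrite subsetUr setU11 /=; apply/forall_inP => t.
  by case/setU1P => [->//|/s't].
rewrite inE; apply/and3P; split.
- by apply/set0Pn; exists (val s'); rewrite setU11.
- by apply/subsetP => t /setU1P[->|/ctL //]; have /andP[] := valP s'.
apply/forall_inP => t /setU1P[->|tc]; apply/forall_inP => u /setU1P[->|uc].
- by rewrite subxx.
- by rewrite s't.
- by rewrite s't ?orbT.
by move/forall_inP: cc => /(_ t tc)/forall_inP/(_ u uc).
Qed.

Definition V_emb k (eps : cochain K k.-1) : embedding (V (restrict eps)) (V eps) :=
  @Embedding (V (restrict eps)) (V eps) sd_emb (@emb_inj _ _ sd_emb) (@V_emb_simp k eps).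

End EmbeddingTheory.

(** [K] is the union of [L1] and [L2], with intersection inside the image of
[L0].  The complex [L0] only serves to bound the number of simplices in the
intersection, in a form that survives subdivision. *)
Record decomposition (K L1 L2 L0 : complex) := Decomposition {
  part1 : embedding L1 K;
  part2 : embedding L2 K;
  overlap : vert L0 -> vert K;
  overlap_inj : injective overlap;
  parts_cover : forall s, s \in simp K ->
    (exists2 t, t \in simp L1 & s = part1 @: t) \/
    (exists2 t, t \in simp L2 & s = part2 @: t);
  parts_meet : forall t1 t2, t1 \in simp L1 -> t2 \in simp L2 ->
    part1 @: t1 = part2 @: t2 ->
    exists2 t0, t0 \in simp L0 & part1 @: t1 = overlap @: t0 }.

Section DecompositionSd.
Variables (K L1 L2 L0 : complex) (D : decomposition K L1 L2 L0).

(** A chain all of whose members lie under a simplex of [L] comes from [L]; in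
particular it suffices that its largest member does. *)
Lemma chain_lift (L : complex) (f : embedding L K) c t :
  c \in simp (Sd K) -> t \in simp L -> (forall s, s \in c -> s \subset f @: t) ->
  exists2 e, e \in simp (Sd L) & c = sd_emb f @: e.
Proof.
rewrite inE => /and3P[c0 /subsetP cK /forall_inP cc] tL ct.
have lift s : s \in c -> f @: (f @^-1: s) = s.
  move=> sc; apply/setP => y; apply/imsetP/idP => [[x]|ys].
    by rewrite inE => xs ->.
  by have /imsetP[x _ yx] := subsetP (ct s sc) _ ys; exists x; rewrite ?inE -?yx.
have cE : c = sd_emb f @: [set f @^-1: (s : {set vert K}) | s in c].
  rewrite -imset_comp -[LHS]imset_id; apply: eq_in_imset => s sc /=.
  by rewrite lift.
exists [set f @^-1: (s : {set vert K}) | s in c] => //.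
rewrite inE; apply/and3P; split.
- by rewrite imset_eq0.
- apply/subsetP => _ /imsetP[s sc ->]; apply: simp_face tL _ _.
    by rewrite -(sub_imset_emb f) lift // ct.
  by rewrite -(imset_eq0 f) lift // (simp_neq0 (cK _ sc)).
apply/forall_inP => _ /imsetP[s sc ->]; apply/forall_inP => _ /imsetP[u uc ->].
by rewrite -!(sub_imset_emb f) !lift //; move/forall_inP: (cc s sc); apply.
Qed.

Lemma sd_parts_cover c : c \in simp (Sd K) ->
  (exists2 e, e \in simp (Sd L1) & c = sd_emb (part1 D) @: e) \/
  (exists2 e, e \in simp (Sd L2) & c = sd_emb (part2 D) @: e).
Proof.
move=> cK; have [s sc smax] := chain_max cK.
have sK : s \in simp K by move: cK; rewrite inE => /and3P[_ /subsetP->].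
have [[t tL sE]|[t tL sE]] := parts_cover D sK; [left|right];
  by apply: chain_lift tL _ => // u uc; rewrite -sE smax.
Qed.

Lemma sd_parts_meet c1 c2 : c1 \in simp (Sd L1) -> c2 \in simp (Sd L2) ->
  sd_emb (part1 D) @: c1 = sd_emb (part2 D) @: c2 ->
  exists2 c0, c0 \in simp (Sd L0) &
    sd_emb (part1 D) @: c1 = [set overlap D @: (s : {set vert L0}) | s in c0].
Proof.
move=> c1L c2L c12.
have := sd_emb_simp (part1 D) c1L; move: c1L c2L.
rewrite !inE => /and3P[_ /subsetP c1L _] /and3P[_ /subsetP c2L _].
case/and3P; set c := imset _ _ => c0 _ /forall_inP cc.
pose e := [set s in simp L0 | overlap D @: s \in c].
have cE : c = [set overlap D @: (s : {set vert L0}) | s in e].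
  apply/setP => u; apply/idP/imsetP => [uc|[s]]; last first.
    by rewrite inE => /andP[_ sc] ->.
  have /imsetP[t1 t1c u1] := uc.
  have : u \in sd_emb (part2 D) @: c2 by rewrite -c12.
  case/imsetP => t2 t2c u2.
  have [t0 t0L E] := parts_meet (c1L _ t1c) (c2L _ t2c) (etrans (esym u1) u2).
  by exists t0; rewrite ?inE -?E -?u1 ?t0L.
exists e => //; rewrite inE; apply/and3P; split.
- by apply: contra_neq c0; rewrite cE => ->; rewrite imset0.
- by apply/subsetP => s; rewrite inE => /andP[].
have sub (s t : {set vert L0}) : overlap D @: s \subset overlap D @: t -> s \subset t.
  move/subsetP => st; apply/subsetP => x xs.
  by have /imsetP[y yt /overlap_inj ->] := st _ (imset_f (overlap D) xs).
apply/forall_inP => s; rewrite inE => /andP[_ sc].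
apply/forall_inP => t; rewrite inE => /andP[_ tc].
by apply/orP; have /orP[/sub|/sub] := forall_inP (cc _ sc) _ tc; [left|right].
Qed.

Definition sd_decomposition : decomposition (Sd K) (Sd L1) (Sd L2) (Sd L0) :=
  @Decomposition (Sd K) (Sd L1) (Sd L2) (Sd L0) (sd_emb (part1 D)) (sd_emb (part2 D))
    (fun s => overlap D @: s) (imset_inj (@overlap_inj _ _ _ _ D))
    sd_parts_cover sd_parts_meet.

(** The piece of [V eps] over each part depends only on the restriction of [eps] to
that part.  This locality is what lets the expectation split. *)
Lemma V_decomposition k (eps : cochain K k.-1) :
  decomposition (V eps) (V (restrict (part1 D) eps)) (V (restrict (part2 D) eps))
    (Sd L0).
Proof.
apply: (@Decomposition (V eps) (V (restrict (part1 D) eps))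
  (V (restrict (part2 D) eps)) (Sd L0) (V_emb (part1 D) eps) (V_emb (part2 D) eps)
    (overlap sd_decomposition) (@overlap_inj _ _ _ _ sd_decomposition)).
  move=> c cV; have cK : c \in simp (Sd K).
    by case/bigcupP: cV => s _; rewrite inE => /andP[].
  have [[e eL cE]|[e eL cE]] := sd_parts_cover cK; [left|right];
    by exists e => //; apply: V_emb_simpV; rewrite // -cE.
have VSd (L : complex) (eps' : cochain L k.-1) c : c \in simp (V eps') -> c \in simp (Sd L).
  by case/bigcupP => s _; rewrite inE => /andP[].
by move=> c1 c2 /VSd c1L /VSd c2L; apply: sd_parts_meet.
Qed.

End DecompositionSd.

Lemma iter_sd_decomposition K L1 L2 L0 d : decomposition K L1 L2 L0 ->
  decomposition (iter d Sd K) (iter d Sd L1) (iter d Sd L2) (iter d Sd L0).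
Proof. by move=> D; elim: d => //= d; apply: sd_decomposition. Qed.

(** * Betti numbers of a decomposed complex *)

Local Open Scope ring_scope.

Lemma card_simplex (K : complex) q : (#|{: simplex K q}| <= #|simp K|)%N.
Proof.
by rewrite card_sig; apply/subset_leq_card/subsetP => s /andP[].
Qed.

Lemma dim_chain (K : complex) q : \dim {:chain K q} = #|{: simplex K q}|.
Proof. by rewrite dimvf /dim /= /dim /= muln1. Qed.

Lemma dim_supported (K : complex) q (A : {set simplex K q}) (U : {vspace chain K q}) :
  (forall c s, c \in U -> s \notin A -> c s = 0) -> (\dim U <= #|A|)%N.
Proof.
move=> UA; pose delta (s : simplex K q) : chain K q := [ffun t => (t == s)%:R].
pose X := [seq delta s | s in A].
rewrite -(size_image delta [in A]); apply: leq_trans (dim_span X).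
apply/dimvS/subvP => c cU.
have deltaE s t : (c s *: delta s) t = if t == s then c s else 0.
  by rewrite !ffunE; case: eqP => _; [apply: mulr1 | apply: mulr0].
have -> : c = \sum_(s in A) c s *: delta s.
  apply/ffunP => t; rewrite sum_ffunE; under eq_bigr do rewrite deltaE.
  rewrite -big_mkcondr /=; have [tA|tA] := boolP (t \in A).
    by rewrite (big_pred1 t) // => s /=; rewrite (eq_sym t); case: eqP => [->|_]; rewrite ?tA ?andbF.
  by rewrite big_pred0 ?(UA c t) // => s; case: eqP tA => [->|_]; rewrite ?andbF ?andbT // => /negPf.
apply: memv_suml => s sA; apply: memvZ; apply: memv_span.
by apply: image_f.
Qed.

Section Push.
Variables (L K : complex) (f : embedding L K).

Definition push q (c : chain L q) : chain K q :=
  [ffun t => \sum_(s | emb_simplex f s == t) c s].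

Lemma push_is_linear q : linear (@push q).
Proof.
move=> a c1 c2; apply/ffunP => t; rewrite !ffunE scaler_sumr -big_split /=.
by apply: eq_bigr => s _; rewrite !ffunE.
Qed.

HB.instance Definition _ q :=
  GRing.isLinear.Build 'F_2 (chain L q) (chain K q) _ (@push q) (@push_is_linear q).

Lemma push_emb q (c : chain L q) s : push c (emb_simplex f s) = c s.
Proof.
rewrite ffunE (big_pred1 s) // => t.
by rewrite (inj_eq (@emb_simplex_inj _ _ f q)).
Qed.

Lemma push_out q (c : chain L q) t :
  (forall s, emb_simplex f s != t) -> push c t = 0.
Proof. by move=> tf; rewrite ffunE big_pred0 // => s; apply/negbTE/tf. Qed.

Lemma push_boundary q (c : chain L q.+1) :
  push (boundary c) = boundary (push c).
Proof.
apply/ffunP => t; rewrite !ffunE.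
transitivity (\sum_(s : simplex L q.+1 | val t \subset f @: val s) c s).
  under eq_bigr do rewrite ffunE.
  rewrite (exchange_big_dep (fun s : simplex L q.+1 => val t \subset f @: val s)) /=; last first.
    by move=> r s /eqP <- rs; rewrite sub_imset_emb.
  apply: eq_bigr => s ts; have [r rE rs] := face_emb ts.
  rewrite (big_pred1 r) // => r'; rewrite rE (inj_eq (@emb_simplex_inj _ _ f q)).
  by rewrite /=; case: eqP => [->|]; rewrite ?rs.
under [RHS]eq_bigr do rewrite ffunE.
rewrite (exchange_big_dep (fun s : simplex L q.+1 => val t \subset f @: val s)) /=; last first.
  by move=> u s tu /eqP uE; rewrite -[f @: _]/(val (emb_simplex f s)) uE.
apply: eq_bigr => s ts; rewrite (big_pred1 (emb_simplex f s)) // => u.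
by rewrite /= [RHS]eq_sym; case: eqP => [<-|_]; rewrite /= ?ts ?andbF.
Qed.

Lemma dim_push q (W : {vspace chain L q}) : \dim (linfun (@push q) @: W) = \dim W.
Proof.
apply: limg_dim_eq; apply/eqP; rewrite -subv0; apply/subvP => c.
rewrite memv_cap memv_ker lfunE /= => /andP[_ /eqP c0].
by rewrite memv0; apply/eqP/ffunP => s; rewrite -push_emb c0 !ffunE.
Qed.

Lemma push_boundaries q :
  (linfun (@push q) @: boundaries L q =
   linfun (@boundary K q) @: (linfun (@push q.+1) @: fullv))%VS.
Proof.
rewrite /boundaries -!limg_comp; congr (_ @: _)%VS; apply/lfunP => c.
by rewrite !comp_lfunE !lfunE /= push_boundary.
Qed.

End Push.

(** The slack is one-sided because a sum of subspaces has dimension at most the sum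
of the dimensions. *)
Definition additive_up_to (m N a b : nat) := (m <= a + b <= m + N)%N.

Section MayerVietoris.
Variables (K L1 L2 L0 : complex) (D : decomposition K L1 L2 L0).
Local Notation f1 := (part1 D).
Local Notation f2 := (part2 D).

(** A chain pushed from both sides is supported on the simplices common to both
parts. *)
Lemma dim_push_meet q (W1 : {vspace chain L1 q}) (W2 : {vspace chain L2 q}) :
  (\dim (linfun (push f1 (q := q)) @: W1 :&: linfun (push f2 (q := q)) @: W2)
     <= #|simp L0|)%N.
Proof.
pose A := [set t : simplex K q | [exists s1, emb_simplex f1 s1 == t]
                               && [exists s2, emb_simplex f2 s2 == t]].
apply: (@leq_trans #|A|).
  apply: dim_supported => c t /memv_capP[/memv_imgP[c1 _ E1] /memv_imgP[c2 _ E2]].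
  rewrite inE negb_and !negb_exists => /orP[] /forallP nt.
    by rewrite E1 lfunE /= push_out.
  by rewrite E2 lfunE /= push_out.
rewrite -(card_imset (mem A) val_inj).
apply: leq_trans (leq_imset_card (fun s : {set vert L0} => overlap D @: s) (mem (simp L0))).
apply/subset_leq_card/subsetP => _ /imsetP[t + ->].
rewrite inE => /andP[/existsP[s1 /eqP E1] /existsP[s2 /eqP E2]].
have /andP[s1L _] := valP s1; have /andP[s2L _] := valP s2.
have := parts_meet (d := D) s1L s2L.
rewrite -[f1 @: _]/(val (emb_simplex f1 s1)) -[f2 @: _]/(val (emb_simplex f2 s2)).
by rewrite E1 E2 => /(_ erefl)[s0 s0L ->]; apply: imset_f.
Qed.

(** A chain is cut into its part on simplices of [L1] and the remainder, which
lives on simplices of [L2]. *)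
Lemma push_full q :
  (linfun (push f1 (q := q)) @: fullv + linfun (push f2 (q := q)) @: fullv)%VS = fullv.
Proof.
apply/vspaceP => c; rewrite memvf; apply/memv_addP.
pose in1 (t : simplex K q) := [exists s1, emb_simplex f1 s1 == t].
pose c1 : chain L1 q := [ffun s => c (emb_simplex f1 s)].
pose c2 : chain L2 q := [ffun s => if in1 (emb_simplex f2 s) then 0
                                   else c (emb_simplex f2 s)].
exists (linfun (push f1 (q := q)) c1); first by rewrite memv_img ?memvf.
exists (linfun (push f2 (q := q)) c2); first by rewrite memv_img ?memvf.
rewrite !lfunE /=; apply/ffunP => t; rewrite [RHS]ffunE.
have [/existsP[s1 /eqP t1]|nt1] := boolP (in1 t).
  rewrite -{2}t1 push_emb ffunE t1.
  have [/existsP[s2 /eqP t2]|] := boolP [exists s2, emb_simplex f2 s2 == t].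
    rewrite -t2 push_emb ffunE ifT ?addr0 // t2.
    by apply/existsP; exists s1; rewrite t1.
  by rewrite negb_exists => /forallP nt2; rewrite push_out ?addr0.
have /andP[tK tq] := valP t.
have [[s sL tE]|[s sL tE]] := parts_cover D tK.
  case/negP: nt1; apply/existsP.
  have sq : is_simplex q s.
    by rewrite /is_simplex sL -(card_imset _ (@emb_inj _ _ f1)) -tE.
  by exists (exist _ s sq); apply/eqP/val_inj.
have sq : is_simplex q s.
  by rewrite /is_simplex sL -(card_imset _ (@emb_inj _ _ f2)) -tE.
have t2 : t = emb_simplex f2 (exist _ s sq) by apply: val_inj.
rewrite push_out ?add0r; last by move: nt1; rewrite negb_exists => /forallP.
by rewrite t2 push_emb ffunE -t2 (negPf nt1).
Qed.

(** Every chain is a sum of chains of the two parts and the pushforwards are chain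
maps, so the boundaries split as well.  No such splitting holds for cycles; this
is why the Betti numbers are expressed through boundaries below. *)
Lemma boundaries_split q :
  boundaries K q = (linfun (push f1 (q := q)) @: boundaries L1 q +
                    linfun (push f2 (q := q)) @: boundaries L2 q)%VS.
Proof. by rewrite !push_boundaries -limgD push_full. Qed.

Lemma dim_push_sum q (W1 : {vspace chain L1 q}) (W2 : {vspace chain L2 q}) :
  additive_up_to (\dim (linfun (push f1 (q := q)) @: W1 + linfun (push f2 (q := q)) @: W2))
    #|simp L0| (\dim W1) (\dim W2).
Proof.
rewrite /additive_up_to -(dim_push f1 W1) -(dim_push f2 W2) -dimv_sum_cap leq_addr /=.
by rewrite leq_add2l dim_push_meet.
Qed.

Lemma dim_chain_split q :
  additive_up_to (\dim {:chain K q}) #|simp L0| (\dim {:chain L1 q}) (\dim {:chain L2 q}).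
Proof. by have := dim_push_sum (q := q) fullv fullv; rewrite push_full. Qed.

Lemma dim_boundaries_split q : additive_up_to (\dim (boundaries K q)) #|simp L0|
  (\dim (boundaries L1 q)) (\dim (boundaries L2 q)).
Proof. by rewrite boundaries_split; apply: dim_push_sum. Qed.

End MayerVietoris.

Section BettiNumbers.
Variable R : realType.

Lemma betti_chain_boundaries (K : complex) q : (betti K q)%:R = (\dim {:chain K q})%:R
   - (if q is q'.+1 then (\dim (boundaries K q'))%:R else 0)
   - (\dim (boundaries K q))%:R :> R.
Proof.
have zE : (\dim (cycles K q) + (if q is q'.+1 then \dim (boundaries K q') else 0) =
   \dim {:chain K q})%N.
  case: q => [|q]; first by rewrite addn0.
  by have := limg_ker_dim (linfun (@boundary K q)) fullv; rewrite capfv.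
have zB : (\dim (boundaries K q) <= \dim (cycles K q))%N.
  case: q {zE} => [|q]; first exact/dimvS/subvf.
  apply/dimvS/subvP => _ /memv_imgP[c _ ->]; rewrite memv_ker !lfunE /=.
  by rewrite boundary_boundary.
rewrite bettiE natrB // -zE natrD; case: q {zE zB} => [|q]; by rewrite ?subr0 ?addr0 // addrK.
Qed.

Lemma betti_le (K : complex) q : (betti K q <= #|simp K|)%N.
Proof.
rewrite bettiE (leq_trans (leq_subr _ _)) // (leq_trans (dimvS (subvf _))) //.
by rewrite dim_chain card_simplex.
Qed.

(** A crude form of Mayer-Vietoris: the Betti number is a signed sum of three
dimensions, each of which is additive up to the size of the overlap. *)
Lemma betti_decomposition K L1 L2 L0 q : decomposition K L1 L2 L0 ->
  `|(betti K q)%:R - (betti L1 q)%:R - (betti L2 q)%:R| <= #|simp L0|%:R *+ 3 :> R.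
Proof.
move=> D; rewrite !betti_chain_boundaries.
have additiveR m N a b : additive_up_to m N a b -> 0 <= (a%:R + b%:R - m%:R :> R) <= N%:R.
  by case/andP; rewrite -!(ler_nat R) !natrD subr_ge0 => -> ?; rewrite lerBlDl.
have /additiveR/andP[c0 c1] := dim_chain_split D q.
have /additiveR/andP[b0 b1] := dim_boundaries_split D q.
rewrite ler_norml.
case: q c0 c1 b0 b1 => [|q] c0 c1 b0 b1.
  have : 0 <= #|simp L0|%:R :> R by [].
  lra.
have /additiveR/andP[d0 d1] := dim_boundaries_split D q.
lra.
Qed.

End BettiNumbers.

(** * Expectation over the cochains *)

Section Marginal.
Variables (R : realType) (nu : R).

Definition weight (x : 'F_2) : R := if x == 0 then nu else 1 - nu.

Lemma sum_weight : \sum_x weight x = 1.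
Proof. by rewrite !big_ord_recl big_ord0 /weight /= addr0 addrC subrK. Qed.

(** Under a product measure, the coordinates indexed by a subset follow the
product measure on this subset: fixing them and summing over the other
coordinates gives a product of factors [nu + (1 - nu) = 1]. *)
Lemma sum_prod_restrict (I J : finType) (g : I -> J) (F : {ffun I -> 'F_2} -> R) :
  injective g ->
  \sum_(eps : {ffun J -> 'F_2}) F [ffun i => eps (g i)] * (\prod_j weight (eps j)) =
  \sum_(e : {ffun I -> 'F_2}) F e * (\prod_i weight (e i)).
Proof.
move=> g_inj.
rewrite (partition_big (fun eps : {ffun J -> 'F_2} => [ffun i => eps (g i)]) xpredT) //=.
apply: eq_bigr => e _.
transitivity (\sum_(eps : {ffun J -> 'F_2} | [ffun i => eps (g i)] == e)
    F e * \prod_j weight (eps j)).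
  by apply: eq_bigr => eps /eqP->.
rewrite -mulr_sumr; congr (_ * _).
pose Q j (x : 'F_2) := [forall i, (g i == j) ==> (x == e i)].
transitivity (\prod_j \sum_(x | Q j x) weight x).
  rewrite bigA_distr_big_dep; apply: eq_bigl => eps.
  apply/eqP/familyP => [E j|epsQ].
    by rewrite unfold_in -E; apply/forallP => i; rewrite ffunE; apply/implyP => /eqP->.
  apply/ffunP => i; rewrite ffunE; have := epsQ (g i).
  by rewrite unfold_in => /forallP/(_ i); rewrite eqxx => /eqP.
rewrite (bigID (mem (g @: I))) /= [X in _ * X]big1 ?mulr1; last first.
  move=> j nj; rewrite -[RHS]sum_weight; apply: eq_bigl => x.
  apply/forallP => i; apply/implyP => /eqP gi.
  by rewrite -gi imset_f in nj.
rewrite big_imset /=; last by move=> ? ? _ _; apply: g_inj.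
apply: eq_big => // i _; rewrite (big_pred1 (e i)) // => x.
apply/forallP/eqP => [/(_ i)|-> i']; first by rewrite eqxx => /eqP.
by rewrite (inj_eq g_inj); apply/implyP => /eqP->.
Qed.

Lemma sum_mu_restrict (L K : complex) (f : embedding L K) q (F : cochain L q -> R) :
  \sum_(eps : cochain K q) F (restrict f eps) * mu nu eps =
  \sum_(e : cochain L q) F e * mu nu e.
Proof. exact: sum_prod_restrict (@emb_simplex_inj _ _ f q). Qed.

Lemma sum_mu (K : complex) q : \sum_(eps : cochain K q) mu nu eps = 1.
Proof.
rewrite -(bigA_distr_bigA (fun _ => weight)) big1 // => i _; exact: sum_weight.
Qed.

Hypothesis nu01 : 0 <= nu <= 1.

Lemma mu_ge0 (K : complex) q (eps : cochain K q) : 0 <= mu nu eps.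
Proof.
by case/andP: nu01 => nu0 nu1; apply: prodr_ge0 => t _; case: ifP; rewrite ?subr_ge0.
Qed.

Variables k p : nat.

Definition mean_betti (K : complex) : R :=
  \sum_(eps : cochain K k.-1) (betti (V eps) p)%:R * mu nu eps.

Lemma le_mean (K : complex) q (F : cochain K q -> R) (B : R) :
  (forall eps, `|F eps| <= B) -> `|\sum_eps F eps * mu nu eps| <= B.
Proof.
move=> FB; apply: le_trans (ler_norm_sum _ _ _) _.
apply: (@le_trans _ _ (\sum_(eps : cochain K q) B * mu nu eps)).
  by apply: ler_sum => eps _; rewrite normrM (ger0_norm (mu_ge0 eps)) ler_wpM2r ?mu_ge0.
by rewrite -mulr_sumr sum_mu mulr1.
Qed.

Lemma mean_betti_decomposition K L1 L2 L0 : decomposition K L1 L2 L0 ->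
  `|mean_betti K - mean_betti L1 - mean_betti L2| <= #|simp (Sd L0)|%:R *+ 3.
Proof.
move=> D; rewrite /mean_betti -(sum_mu_restrict (part1 D)) -(sum_mu_restrict (part2 D)).
rewrite -!sumrB; under eq_bigr do rewrite -!mulrBl.
by apply: le_mean => eps; apply: betti_decomposition; apply: V_decomposition.
Qed.

Lemma mean_betti_le K : `|mean_betti K| <= #|simp (Sd K)|%:R.
Proof.
apply: le_mean => eps; rewrite normr_nat ler_nat (leq_trans (betti_le _ _)) //.
by apply/subset_leq_card/subsetP => c /bigcupP[s _]; rewrite inE => /andP[].
Qed.

Local Notation E K d := (expected_betti nu K k p d).

Lemma expected_betti_Sd K d : E (Sd K) d = E K d.+1.
Proof.
rewrite -[LHS]/(mean_betti (iter d Sd (Sd K))) -[RHS]/(mean_betti (iter d.+1 Sd K)).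
by rewrite iterSr.
Qed.

Lemma expected_betti_le m K N d : covered m K N ->
  `|E K d| <= N%:R * m`!%:R ^+ d.+1 * 2 ^+ m.
Proof.
move=> KN; apply: le_trans (mean_betti_le (iter d Sd K)) _.
by rewrite -!(natrX, natrM) ler_nat; apply: (card_iter_Sd d.+1 KN).
Qed.

(** The error is the size of the overlap after [d.+1] subdivisions: [d] for the
complex that carries the cochain, and one more for [V]. *)
Lemma expected_betti_decomposition m K L1 L2 L0 N d :
  decomposition K L1 L2 L0 -> covered m L0 N ->
  `|E K d - E L1 d - E L2 d| <= (N%:R * m`!%:R ^+ d.+1 * 2 ^+ m) *+ 3.
Proof.
move=> D LN.
apply: le_trans (mean_betti_decomposition (iter_sd_decomposition d D)) _.
rewrite lerMn2r -!(natrX, natrM) ler_nat; exact: (card_iter_Sd d.+1 LN).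
Qed.

End Marginal.

(** * Comparison with the standard simplex *)

Section RemoveSimplex.
Variables (K : complex) (s : {set vert K}).
Hypothesis sK : s \in simp K.
Hypothesis smax : forall t, t \in simp K -> s \subset t -> t = s.

Lemma remove_neq0 (t : {set vert K}) : t \in simp K :\ s -> t != set0.
Proof. by rewrite inE => /andP[_ /simp_neq0]. Qed.

Lemma remove_face (t u : {set vert K}) : t \in simp K :\ s -> u \subset t ->
  u != set0 -> u \in simp K :\ s.
Proof.
rewrite !inE => /andP[ts tK] ut u0; rewrite (simp_face tK ut u0) andbT.
by apply: contraNneq ts => us; apply/eqP/smax; rewrite // -us.
Qed.

Definition remove : complex := Complex remove_neq0 remove_face.

Lemma proper_faces_neq0 (t : {set vert K}) :
  t \in [set u in simp K | u \proper s] -> t != set0.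
Proof. by rewrite inE => /andP[/simp_neq0]. Qed.

Lemma proper_faces_face (t u : {set vert K}) :
  t \in [set u in simp K | u \proper s] -> u \subset t -> u != set0 ->
  u \in [set u in simp K | u \proper s].
Proof.
rewrite !inE => /andP[tK ts] ut u0.
by rewrite (simp_face tK ut u0) (sub_proper_trans ut ts).
Qed.

Definition proper_faces : complex := Complex proper_faces_neq0 proper_faces_face.

Lemma remove_emb_simp (t : {set vert remove}) :
  t \in simp remove -> [set id x | x in t] \in simp K.
Proof. by rewrite imset_id inE => /andP[]. Qed.

Definition remove_emb : embedding remove K :=
  @Embedding remove K id (fun _ _ => id) remove_emb_simp.

Lemma std_emb_simp (t : {set vert (std_simplex #|s|)}) :
  t \in simp (std_simplex #|s|) -> (@enum_val _ (mem s)) @: t \in simp K.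
Proof.
rewrite inE => t0; apply: simp_face sK _ _; last by rewrite imset_eq0.
by apply/subsetP => _ /imsetP[i _ ->]; apply: enum_valP.
Qed.

Definition std_emb : embedding (std_simplex #|s|) K :=
  @Embedding (std_simplex #|s|) K (@enum_val _ (mem s)) (@enum_val_inj _ _) std_emb_simp.

(** Maximality of [s] is what makes the remainder a complex.  The closed simplex is
presented as a standard one, so that its expectation depends on [#|s|] only. *)
Lemma remove_decomposition :
  decomposition K remove (std_simplex #|s|) proper_faces.
Proof.
apply: (@Decomposition K remove (std_simplex #|s|) proper_faces remove_emb std_emb id) => //.
  move=> t tK; have [->|ts] := eqVneq t s; [right|left]; last first.
    by exists t; rewrite ?imset_id // !inE ts.
  exists setT.
    by rewrite inE -card_gt0 cardsT card_ord card_gt0 (simp_neq0 sK).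
  apply/setP => x; apply/idP/imsetP => [xs|[i _ ->]]; last exact: enum_valP.
  by exists (enum_rank_in xs x); rewrite ?inE //= enum_rankK_in.
move=> t1 t2 /= t1K t2K t12; exists t1; last by [].
move: t1K; rewrite !inE => /andP[t1s ->] /=; rewrite properEneq t1s /=.
rewrite -(imset_id t1) t12; apply/subsetP => _ /imsetP[i _ ->]; exact: enum_valP.
Qed.

Lemma card_remove : #|simp K| = #|simp remove|.+1.
Proof. by rewrite (cardsD1 s) sK. Qed.

Lemma f_remove n : f_ n K = ((#|s| == n.+1) + f_ n remove)%N.
Proof.
rewrite /f_ !card_sig (cardD1 s) /= unfold_in /= /is_simplex sK; congr (_ + _)%N.
by apply: eq_card => t; rewrite !inE andbA.
Qed.

End RemoveSimplex.

Section Approximation.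
Variables (R : realType) (nu : R) (k p n : nat).
Hypothesis nu01 : 0 <= nu <= 1.
Local Notation E K d := (expected_betti nu K k p d).

(** Simplices are deleted one at a time, by decreasing dimension.  Each deletion
costs an overlap of dimension less than [n], hence an error of order [n`! ^ d];
a deleted simplex of dimension [n] contributes the value of the standard
simplex, and one of smaller dimension is itself absorbed by the error. *)
Lemma expected_betti_approx K : (forall s, s \in simp K -> (#|s| <= n.+1)%N) ->
  exists C : R, forall d,
    `|E K d - (f_ n K)%:R * E (std_simplex n.+1) d| <= C * n`!%:R ^+ d.
Proof.
move: {2}#|simp K| (erefl #|simp K|) => N; elim: N K => [|N IHN] K cN Kn.
  exists 0 => d; rewrite mul0r normr_le0.
  have -> : f_ n K = 0%N.
    by apply/eqP; rewrite -leqn0 -cN; apply: card_simplex.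
  rewrite mul0r subr0 -normr_le0.
  by have := expected_betti_le nu01 k p d (covered_self Kn); rewrite cN !mul0r.
have [s0 s0K] : exists s, s \in simp K by apply/set0Pn; rewrite -card_gt0 cN.
case: (arg_maxnP (fun s : {set vert K} => #|s|) s0K) => s sK scard.
have smax t : t \in simp K -> s \subset t -> t = s.
  by move=> tK st; apply/esym/eqP; rewrite eqEcard st; apply: scard.
have [||C CP] := IHN (remove smax).
- by move: cN; rewrite (card_remove sK smax) => -[].
- by move=> t; rewrite inE => /andP[_ /Kn].
have D := remove_decomposition sK smax.
have Lc : covered n (proper_faces s) #|simp (proper_faces s)|.
  apply: covered_self => t; rewrite inE => /andP[_ /proper_card ts].
  by rewrite -ltnS (leq_trans ts) // Kn.
(* A simplex of dimension below n has at most c faces after one subdivision;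
   this accounts for the subdivision in which V is formed. *)
pose c : R := n`!%:R * 2 ^+ n.
exists (C + (#|simp (proper_faces s)|%:R * c) *+ 3 + c) => d.
rewrite (f_remove sK smax n) natrD mulrDl.
have c1 := expected_betti_decomposition nu01 k p d D Lc.
have c2 := CP d.
have c3 : `|E (std_simplex #|s|) d - (#|s| == n.+1)%:R * E (std_simplex n.+1) d|
    <= c * n`!%:R ^+ d.
  have [->|sn] := eqVneq #|s| n.+1.
    by rewrite mul1r subrr normr0 !mulr_ge0 ?exprn_ge0.
  rewrite mul0r subr0.
  have sn' : (#|s| <= n)%N by rewrite -ltnS ltn_neqAle sn Kn.
  have := expected_betti_le nu01 k p d (covered_weaken sn' (covered_std _)).
  by rewrite mul1r exprS /c mulrAC.
have -> : E K d - ((#|s| == n.+1)%:R * E (std_simplex n.+1) d +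
     (f_ n (remove smax))%:R * E (std_simplex n.+1) d) =
  (E K d - E (remove smax) d - E (std_simplex #|s|) d) +
  (E (remove smax) d - (f_ n (remove smax))%:R * E (std_simplex n.+1) d) +
  (E (std_simplex #|s|) d - (#|s| == n.+1)%:R * E (std_simplex n.+1) d) by ring.
rewrite 2!mulrDl; apply: le_trans (ler_normD _ _) (lerD _ c3).
rewrite addrC; apply: le_trans (ler_normD _ _) _; rewrite addrC.
rewrite [leRHS]addrC; apply: lerD => //.
by move: c1; rewrite exprS -mulrnAl /c; congr (_ <= _); ring.
Qed.

(** The [d.+1]-st subdivision of the standard simplex is the [d]-th subdivision of
its first one, which has [(n.+1)`!] simplices of dimension [n]. *)
Lemma expected_betti_std_step : exists C : R, forall d,
  `|E (std_simplex n.+1) d.+1 - (n.+1)`!%:R * E (std_simplex n.+1) d| <= C * n`!%:R ^+ d.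
Proof.
have [|C CP] := @expected_betti_approx (Sd (std_simplex n.+1)).
  by move=> s; apply: covered_leq (covered_Sd (covered_std n.+1)).
by exists C => d; rewrite -expected_betti_Sd -f_Sd_std.
Qed.

End Approximation.

(** * Convergence *)

Local Open Scope classical_set_scope.
Local Open Scope ring_scope.

Lemma cvg_geometric_increments (R : realType) (u : nat -> R) (C z : R) :
  0 <= z < 1 -> (forall d, `|u d.+1 - u d| <= C * z ^+ d) -> cvgn u.
Proof.
move=> /andP[z0 z1] uC.
have ->: u = cst (u 0%N) + series (telescope u).
  by apply/funext => d; rewrite [LHS]eq_sum_telescope.
apply: is_cvgD; first exact: is_cvg_cst.
apply: normed_cvg.
apply: (@series_le_cvg _ _ (geometric C z)) => [d|d|d|].
- exact: normr_ge0.
- exact: le_trans (uC d).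
- exact: uC.
by apply: is_cvg_geometric_series; rewrite ger0_norm.
Qed.

Theorem theorem1p1 (R : realType) (n k p : nat) (nu : R) :
  (0 < n)%N -> (1 <= k <= n)%N -> (p <= n - k)%N -> 0 <= nu <= 1 ->
  exists L : R, forall K : complex, has_dim K n ->
    (fun d : nat => expected_betti nu K k p d /
                    ((f_ n K)%:R * (n.+1)`!%:R ^+ d)) @ \oo --> L.
Proof.
move=> n0 _ _ nu01.
pose N : R := (n.+1)`!%:R; pose z : R := n.+1%:R^-1.
have Npos : 0 < N by rewrite ltr0n fact_gt0.
have z01 : 0 <= z < 1.
  by rewrite invr_ge0 ler0n invf_lt1 ?ltr0n // ltr1n ltnS.
have zE d : n`!%:R ^+ d / N ^+ d = z ^+ d.
  rewrite -expr_div_n; congr (_ ^+ d).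
  by rewrite /N factS natrM invfM mulrCA divff ?mulr1 // pnatr_eq0 -lt0n fact_gt0.
pose u d : R := expected_betti nu (std_simplex n.+1) k p d / N ^+ d.
have cu : cvgn u.
  have [C CP] := expected_betti_std_step k p n nu01.
  apply: (@cvg_geometric_increments _ _ (C / N) z z01) => d.
  have -> : u d.+1 - u d = (expected_betti nu (std_simplex n.+1) k p d.+1 -
      N * expected_betti nu (std_simplex n.+1) k p d) / N ^+ d.+1.
    rewrite mulrBl; congr (_ - _); rewrite exprS invfM mulrACA divff ?mul1r //.
    exact: lt0r_neq0.
  rewrite normrM normfV [`|N ^+ _|]ger0_norm ?exprn_ge0 ?(ltW Npos) //.
  rewrite ler_pdivrMr ?exprn_gt0 // -zE exprS.
  apply: le_trans (CP d) _; rewrite le_eqVlt; apply/orP; left; apply/eqP.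
  have NX : N ^+ d != 0 by rewrite expf_neq0 // lt0r_neq0.
  have Nn : N != 0 by rewrite lt0r_neq0.
  by rewrite mulrACA divfK // divfK.
exists (limn u) => K [[s sK sn] Kn].
have f0 : (0 : R) < (f_ n K)%:R.
  rewrite ltr0n; apply/card_gt0P; have sP : is_simplex n s by rewrite /is_simplex sK sn eqxx.
  by exists (exist _ s sP).
have [C CP] := expected_betti_approx k p nu01 Kn.
set v := fun d => _.
have -> : v = u + (v - u) by rewrite addrC subrK.
rewrite -[limn u]addr0; apply: cvgD => //.
apply/norm_cvg0P.
apply: (@squeeze_cvgr _ _ _ _ (cst 0) (geometric (C / (f_ n K)%:R) z)).
- near=> d; rewrite normr_ge0 /=.
  have -> : (v - u) d = (expected_betti nu K k p d -
     (f_ n K)%:R * expected_betti nu (std_simplex n.+1) k p d) /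
       ((f_ n K)%:R * N ^+ d).
    rewrite mulrBl; congr (_ - _).
    by rewrite invfM mulrACA divff ?mul1r // lt0r_neq0.
  rewrite normrM normfV [`|_ * N ^+ d|]ger0_norm; last first.
    by rewrite mulr_ge0 ?ler0n // exprn_ge0 // ltW.
  rewrite ler_pdivrMr ?mulr_gt0 ?exprn_gt0 // -zE.
  rewrite mulrACA divfK ?lt0r_neq0 // divfK ?lt0r_neq0 ?exprn_gt0 //.
- exact: cvg_cst.
by apply: cvg_geometric; case/andP: z01 => z0 z1; rewrite ger0_norm.
Unshelve. all: by end_near.
Qed.
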